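(* Let $q\in[2,\infty)$. Then $[\mathcal{C}_q^{\mathrm{Lip}_0},\|\cdot\|_{\mathcal{C}_q^{\mathrm{Lip}}}]$ is not a Banach Lipschitz ideal.
   Context: $\mathbb{K}$ is the scalar field ($\mathbb{R}$ or $\mathbb{C}$). For Banach spaces $X,E$, $\mathcal{L}(X,E)$ is the space of bounded linear operators, and $\mathrm{Lip}_0(X,E)$ is the Banach space of Lipschitz maps $f:X\to E$ with $f(0)=0$, normed by $\mathrm{Lip}(f)=\sup_{x\ne y}\|f(x)-f(y)\|/\|x-y\|$; $\mathrm{Lip}_0(X)=\mathrm{Lip}_0(X,\mathbb{K})$. $(r_n)_{n\in\mathbb{N}}$ are the Rademacher functions on $[0,1]$. $f\in\mathrm{Lip}_0(X,E)$ has cotype $q$ if there is $K>0$ such that for all $N\in\mathbb{N}$, $(\lambda_1,\ldots,\lambda_N)\in\mathbb{R}^N$ and $(x_1,\ldots,x_N),(y_1,\ldots,y_N)\in X^N$, $$\left(\sum_{k=1}^N|\lambda_k|^q\|f(x_k)-f(y_k)\|_E^q\right)^{1/q}\le K\left(\int_0^1\Big\|\sum_{k=1}^N\lambda_k r_k(t)(x_k-y_k)\Big\|_X^2dt\right)^{1/2}.$$ The set of such $f$ is $\mathcal{C}_q^{\mathrm{Lip}_0}(X,E)$ and $\|f\|_{\mathcal{C}_q^{\mathrm{Lip}}}$ is the infimum of all such $K$. A Banach Lipschitz ideal is a subclass $\mathcal{A}$ of the class of all zero-preserving Lipschitz maps between Banach spaces, with a map $\|\cdot\|_{\mathcal{A}}:\mathcal{A}\to[0,\infty)$,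 such that for all Banach spaces $X,E$ the components $\mathcal{A}(X,E):=\mathrm{Lip}_0(X,E)\cap\mathcal{A}$ satisfy: (i) $(\mathcal{A}(X,E),\|\cdot\|_{\mathcal{A}})$ is a Banach space and $\mathrm{Lip}(f)\le\|f\|_{\mathcal{A}}$ for all $f\in\mathcal{A}(X,E)$; (ii) for all $h\in\mathrm{Lip}_0(X)$ and $y\in E$, the map $h\cdot y:x\mapsto h(x)y$ is in $\mathcal{A}(X,E)$ and $\|h\cdot y\|_{\mathcal{A}}=\mathrm{Lip}(h)\|y\|$; (iii) for all Banach spaces $X_0,E_0$, $T\in\mathcal{L}(E,E_0)$, $f\in\mathcal{A}(X,E)$, $h\in\mathrm{Lip}_0(X_0,X)$, one has $T\circ f\circ h\in\mathcal{A}(X_0,E_0)$ with $\|T\circ f\circ h\|_{\mathcal{A}}\le\|T\|\,\|f\|_{\mathcal{A}}\,\mathrm{Lip}(h)$. *)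

(* Defs.v *)
From Stdlib Require Import Reals.
From Coquelicot Require Import Coquelicot.

Open Scope R_scope.

(** A Banach space over the field named by [k] is a
    [CompleteNormedModule (scalars k)]: Coquelicot's norms are real-valued over
    both fields, and bounded linear operators are [is_linear] maps. *)

Inductive scalar_field := RealField | ComplexField.

Definition scalars (k : scalar_field) : AbsRing :=
  match k with RealField => R_AbsRing | ComplexField => C_AbsRing end.

Definition of_real (k : scalar_field) : R -> scalars k :=
  match k with RealField => fun x => x | ComplexField => RtoC end.

(** [rpow x q] is [x^q] for [0 <= x] and [0 < q].  The case [x = 0] is separate
    because [Rpower 0 q = 1]. *)
Definition rpow (x q : R) : R :=
  if Req_EM_T x 0 then 0 else Rpower x q.

Definition rademacher (n : nat) (t : R) : R := sign (sin (2 ^ n * PI * t)).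

Section Lipschitz.
Context {K : AbsRing} {X E : NormedModule K}.

Definition lip0 (f : X -> E) : Prop :=
  f zero = zero /\
  exists L : R, forall x y : X, norm (minus (f x) (f y)) <= L * norm (minus x y).

(** If [X] is trivial the set is empty; its least upper bound is then [m_infty],
    which [real] sends to [0]. *)
Definition lip_const (f : X -> E) : R :=
  real (Lub_Rbar (fun r => exists x y : X,
    x <> y /\ r = norm (minus (f x) (f y)) / norm (minus x y))).

Definition op_norm (T : X -> E) : R :=
  real (Lub_Rbar (fun r => exists x : X, norm x <= 1 /\ r = norm (T x))).

(** The functions satisfying [A], with pointwise operations and norm [nA], form
    a Banach space.  The values of [nA] outside [A] are irrelevant. *)
Record is_banach_function_space (A : (X -> E) -> Prop) (nA : (X -> E) -> R)
  : Prop := {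
  bfs_zero : A (fun _ => zero);
  bfs_plus : forall f g, A f -> A g -> A (fun x => plus (f x) (g x));
  bfs_scal : forall (a : K) f, A f -> A (fun x => scal a (f x));
  bfs_norm_ge0 : forall f, A f -> 0 <= nA f;
  bfs_norm_eq0 : forall f, A f -> nA f = 0 -> forall x, f x = zero;
  bfs_norm_scal : forall (a : K) f, A f -> nA (fun x => scal a (f x)) = abs a * nA f;
  bfs_norm_triangle : forall f g, A f -> A g ->
    nA (fun x => plus (f x) (g x)) <= nA f + nA g;
  bfs_complete : forall u : nat -> X -> E,
    (forall n, A (u n)) ->
    (forall eps : R, 0 < eps -> exists N : nat, forall n m : nat,
       (N <= n)%nat -> (N <= m)%nat -> nA (fun x => minus (u n x) (u m x)) < eps) ->
    exists f, A f /\ is_lim_seq (fun n => nA (fun x => minus (u n x) (f x))) 0 }.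

End Lipschitz.

(** [A X E] is the component at [(X, E)], as a predicate on maps [X -> E]. *)
Record is_banach_lipschitz_ideal (K : AbsRing)
    (A : forall X E : CompleteNormedModule K, (X -> E) -> Prop)
    (nA : forall X E : CompleteNormedModule K, (X -> E) -> R) : Prop := {
  bli_lip0 : forall (X E : CompleteNormedModule K) (f : X -> E), A X E f -> lip0 f;
  bli_banach : forall X E : CompleteNormedModule K,
    is_banach_function_space (A X E) (nA X E);
  bli_lip_le : forall (X E : CompleteNormedModule K) (f : X -> E),
    A X E f -> lip_const f <= nA X E f;
  bli_rank_one : forall (X E : CompleteNormedModule K)
      (h : X -> AbsRing_NormedModule K) (y : E), lip0 h ->
    A X E (fun x => scal (h x) y) /\
    nA X E (fun x => scal (h x) y) = lip_const h * norm y;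
  bli_comp : forall (X E X0 E0 : CompleteNormedModule K)
      (T : E -> E0) (f : X -> E) (h : X0 -> X),
    is_linear T -> A X E f -> lip0 h ->
    A X0 E0 (fun x => T (f (h x))) /\
    nA X0 E0 (fun x => T (f (h x))) <= op_norm T * nA X E f * lip_const h }.

Section Cotype.
Context (k : scalar_field) (q : R) {X E : CompleteNormedModule (scalars k)}.

(** Only the entries of index [1, ..., N] of the sequences [lam], [x], [y] are
    used.  The integrand is a step function of [t], so the Riemann integral
    exists. *)
Definition cotype_bound (f : X -> E) (C : R) : Prop :=
  forall (N : nat) (lam : nat -> R) (x y : nat -> X),
    rpow (sum_n_m (fun i => rpow (Rabs (lam i)) q *
                            rpow (norm (minus (f (x i)) (f (y i)))) q) 1 N) (/ q)
    <= C * sqrt (RInt (fun t =>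
         norm (sum_n_m (fun i => scal (of_real k (lam i * rademacher i t))
                                      (minus (x i) (y i))) 1 N) ^ 2) 0 1).

Definition lip_cotype (f : X -> E) : Prop :=
  lip0 f /\ exists C : R, 0 < C /\ cotype_bound f C.

Definition cotype_norm (f : X -> E) : R :=
  real (Glb_Rbar (fun C => 0 < C /\ cotype_bound f C)).

End Cotype.

(* Main.v *)
Require Import Defs.
From Stdlib Require Import Reals Lra.
From Coquelicot Require Import Coquelicot.

(** On the plane with the max norm, the norm [h] is a scalar Lipschitz map of
    constant 1, so (ii) would force its cotype norm to be 1.  But testing the
    cotype inequality on the two basis vectors against 0 gives [2^(1/q)] on the
    left, while every Rademacher combination of them has max norm 1. *)

(** * The product of two Banach spaces under the max norm *)

Section SupProduct.
Context {K : AbsRing} {U V : CompleteNormedModule K}.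

(** The max is essential: under the Euclidean norm the combinations [e1 ± e2] have norm [sqrt 2],
    and [2^(1/q) <= sqrt 2] for [q >= 2] gives no contradiction. *)
Definition sup_norm (x : U * V) : R := Rmax (norm (fst x)) (norm (snd x)).

Lemma sup_norm_triangle (x y : U * V) :
  sup_norm (plus x y) <= sup_norm x + sup_norm y.
Proof.
  unfold sup_norm; apply Rmax_lub; simpl.
  - eapply Rle_trans; [apply (norm_triangle (fst x) (fst y))|].
    apply Rplus_le_compat; apply Rmax_l.
  - eapply Rle_trans; [apply (norm_triangle (snd x) (snd y))|].
    apply Rplus_le_compat; apply Rmax_r.
Qed.

Lemma sup_norm_scal (a : K) (x : U * V) :
  sup_norm (scal a x) <= abs a * sup_norm x.
Proof.
  unfold sup_norm; rewrite <- RmaxRmult by apply abs_ge_0.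
  apply Rmax_lub; simpl.
  - eapply Rle_trans; [apply (norm_scal a (fst x))|apply Rmax_l].
  - eapply Rle_trans; [apply (norm_scal a (snd x))|apply Rmax_r].
Qed.

Lemma sup_norm_compat1 (x y : U * V) (eps : R) :
  sup_norm (minus y x) < eps -> ball x eps y.
Proof.
  intros H; split.
  - apply (norm_compat1 (V := U)).
    eapply Rle_lt_trans; [apply Rmax_l|exact H].
  - apply (norm_compat1 (V := V)).
    eapply Rle_lt_trans; [apply Rmax_r|exact H].
Qed.

(** The max norm is at most the Euclidean product norm, so it inherits the factor of the latter. *)
Lemma sup_norm_compat2 (x y : U * V) (eps : posreal) :
  ball x eps y ->
  sup_norm (minus y x) < prod_norm_factor (K := K) (U := U) (V := V) * eps.
Proof.
  intros H; eapply Rle_lt_trans; [|exact (prod_norm_compat2 x y eps H)].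
  apply Rmax_lub;
    [exact (norm_le_prod_norm_1 (minus y x))|exact (norm_le_prod_norm_2 (minus y x))].
Qed.

Lemma sup_norm_eq_zero (x : U * V) : sup_norm x = 0 -> x = zero.
Proof.
  unfold sup_norm; intros H; destruct x as [u v]; simpl in H.
  assert (norm u <= 0) by (rewrite <- H; apply Rmax_l).
  assert (norm v <= 0) by (rewrite <- H; apply Rmax_r).
  pose proof (norm_ge_0 u); pose proof (norm_ge_0 v).
  rewrite (norm_eq_zero u), (norm_eq_zero v) by lra; reflexivity.
Qed.

Definition sup_prod_lim (F : (U * V -> Prop) -> Prop) : U * V :=
  (lim (filtermap fst F), lim (filtermap snd F)).

Lemma sup_prod_complete (F : (U * V -> Prop) -> Prop) :
  ProperFilter F -> cauchy F ->
  forall eps : posreal, F (ball (sup_prod_lim F) eps).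
Proof.
  intros FF HF eps.
  assert (H1 : F (fun x => ball (lim (filtermap fst F)) eps (fst x))).
  { apply (complete_cauchy (filtermap fst F)).
    - apply filtermap_proper_filter, FF.
    - intros d; destruct (HF d) as [x Hx]; exists (fst x).
      apply (filter_imp (F := F) (ball x d)); [intros z Hz; apply Hz|exact Hx]. }
  assert (H2 : F (fun x => ball (lim (filtermap snd F)) eps (snd x))).
  { apply (complete_cauchy (filtermap snd F)).
    - apply filtermap_proper_filter, FF.
    - intros d; destruct (HF d) as [x Hx]; exists (snd x).
      apply (filter_imp (F := F) (ball x d)); [intros z Hz; apply Hz|exact Hx]. }
  eapply filter_imp; [|exact (filter_and _ _ H1 H2)].
  intros z Hz; exact Hz.
Qed.

Lemma sup_prod_lim_close (F1 F2 : (U * V -> Prop) -> Prop) :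
  filter_le F1 F2 -> filter_le F2 F1 -> close (sup_prod_lim F1) (sup_prod_lim F2).
Proof.
  intros H12 H21 eps; split.
  - apply (close_lim (T := U)); intros P HP; [exact (H12 _ HP)|exact (H21 _ HP)].
  - apply (close_lim (T := V)); intros P HP; [exact (H12 _ HP)|exact (H21 _ HP)].
Qed.

(** Only the norm of the usual product is replaced; its algebra and its uniform structure are kept,
    so balls remain products of balls. *)
Definition sup_prod_NormedModule : NormedModule K :=
  NormedModule.Pack K (U * V)
    (NormedModule.Class K (U * V)
      (NormedModuleAux.class K (prod_NormedModuleAux K U V))
      (NormedModule.Mixin K (prod_NormedModuleAux K U V) sup_norm prod_norm_factor
        sup_norm_triangle sup_norm_scal sup_norm_compat1 sup_norm_compat2
        sup_norm_eq_zero)) (U * V).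

Definition sup_prod : CompleteNormedModule K :=
  CompleteNormedModule.Pack K (U * V)
    (CompleteNormedModule.Class K (U * V)
      (NormedModule.class K sup_prod_NormedModule)
      (CompleteSpace.Mixin (prod_UniformSpace U V) sup_prod_lim
        sup_prod_complete sup_prod_lim_close)) (U * V).

End SupProduct.

Arguments sup_prod {K} U V.

(** * The scalar field as a Banach space over itself *)

Definition scalar_space (k : scalar_field) : CompleteNormedModule (scalars k) :=
  match k with
  | RealField => R_CompleteNormedModule
  | ComplexField => C_CompleteNormedModule
  end.

Definition unit_vector (k : scalar_field) : scalar_space k :=
  match k with RealField => 1 | ComplexField => RtoC 1 end.

Lemma of_real_1 (k : scalar_field) : of_real k 1 = one.
Proof. destruct k; reflexivity. Qed.

Lemma of_real_0 (k : scalar_field) : of_real k 0 = zero.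
Proof. destruct k; reflexivity. Qed.

Lemma norm_of_real_minus (k : scalar_field) (a b : R) :
  norm (minus (of_real k a : AbsRing_NormedModule (scalars k)) (of_real k b))
  = Rabs (a - b).
Proof.
  destruct k; simpl; [reflexivity|].
  change (Cmod (RtoC a - RtoC b) = Rabs (a - b)).
  rewrite <- RtoC_minus; apply Cmod_R.
Qed.

Lemma norm_scal_unit_vector (k : scalar_field) (a : R) :
  norm (scal (of_real k a) (unit_vector k)) = Rabs a.
Proof.
  destruct k; simpl.
  - change (Rabs (a * 1) = Rabs a); now rewrite Rmult_1_r.
  - change (Cmod (RtoC a * RtoC 1) = Rabs a).
    rewrite Cmult_1_r; apply Cmod_R.
Qed.

Lemma norm_minus_scal_unit_vector (k : scalar_field) (a b : R) :
  norm (minus (scal (of_real k a) (unit_vector k))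
              (scal (of_real k b) (unit_vector k))) = Rabs (a - b).
Proof.
  destruct k; simpl.
  - change (Rabs (a * 1 - b * 1) = Rabs (a - b)); now rewrite !Rmult_1_r.
  - change (Cmod (RtoC a * RtoC 1 - RtoC b * RtoC 1) = Rabs (a - b)).
    rewrite !Cmult_1_r, <- RtoC_minus; apply Cmod_R.
Qed.

Lemma norm_unit_vector (k : scalar_field) : norm (unit_vector k) = 1.
Proof.
  rewrite <- (scal_one (unit_vector k)), <- of_real_1, norm_scal_unit_vector.
  apply Rabs_R1.
Qed.

(** * Bounds on the Lipschitz constant and on the cotype norm *)

Lemma lip_const_le {K : AbsRing} {X E : NormedModule K} (f : X -> E) (L : R) :
  0 <= L -> (forall x y, norm (minus (f x) (f y)) <= L * norm (minus x y)) ->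
  lip_const f <= L.
Proof.
  intros HL Hf; unfold lip_const.
  match goal with |- real (Lub_Rbar ?S) <= _ => set (D := S) end.
  assert (H : Rbar_le (Lub_Rbar D) L).
  { apply Lub_Rbar_correct; intros r [x [y [Hxy ->]]]; simpl.
    assert (Hn : 0 < norm (minus x y)).
    { destruct (norm_ge_0 (minus x y)) as [Hn|Hn]; [exact Hn|].
      exfalso; apply Hxy, (plus_reg_r (opp y)).
      rewrite plus_opp_r; apply norm_eq_zero; auto. }
    apply Rle_div_l; [exact Hn|apply Hf]. }
  (* If there are no two distinct points, the bound is [m_infty], which [real] sends to 0; this case
     uses [0 <= L]. *)
  destruct (Lub_Rbar D); simpl in *; tauto || lra.
Qed.

(** Since [real] sends infinite values to 0, the infimum must be shown finite: an admissible [C0]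
    excludes [p_infty], and the lower bound [m] excludes [m_infty]. *)
Lemma cotype_norm_ge (k : scalar_field) (q m : R)
    {X E : CompleteNormedModule (scalars k)} (f : X -> E) :
  lip_cotype k q f -> (forall C, 0 < C -> cotype_bound k q f C -> m <= C) ->
  m <= cotype_norm k q f.
Proof.
  intros [_ [C0 HC0]] Hm; unfold cotype_norm.
  match goal with |- _ <= real (Glb_Rbar ?S) => set (D := S) end.
  assert (H1 : Rbar_le m (Glb_Rbar D)).
  { apply Glb_Rbar_correct; intros C [H1 H2]; apply (Hm C H1 H2). }
  assert (H2 : Rbar_le (Glb_Rbar D) C0) by (apply Glb_Rbar_correct, HC0).
  destruct (Glb_Rbar D); simpl in *; tauto.
Qed.

(** * The first two Rademacher functions *)

Lemma Rabs_sign_le (x : R) : Rabs (sign x) <= 1.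
Proof.
  destruct (Rtotal_order x 0) as [H|[->|H]].
  - rewrite sign_eq_m1 by exact H; apply Rabs_le; lra.
  - rewrite sign_0, Rabs_R0; lra.
  - rewrite sign_eq_1, Rabs_R1 by exact H; lra.
Qed.

Lemma rademacher_1_l (t : R) : 0 < t < 1 / 2 -> rademacher 1 t = 1.
Proof.
  intros Ht; pose proof PI_RGT_0; unfold rademacher.
  apply sign_eq_1, sin_gt_0; nra.
Qed.

Lemma rademacher_1_r (t : R) : 1 / 2 < t < 1 -> rademacher 1 t = -1.
Proof.
  intros Ht; pose proof PI_RGT_0; unfold rademacher.
  apply sign_eq_m1, sin_lt_0; nra.
Qed.

(** The integrand is 1 wherever [rademacher 1] is 1 or -1, because [rademacher 2] never exceeds 1 in
    modulus. The exceptions 0, 1/2 and 1 become endpoints once the interval is cut at 1/2. *)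
Lemma is_RInt_rademacher_max :
  is_RInt (fun t => Rmax (Rabs (rademacher 1 t)) (Rabs (rademacher 2 t)) ^ 2) 0 1 1.
Proof.
  assert (H : forall t, Rabs (rademacher 1 t) = 1 ->
    1 = Rmax (Rabs (rademacher 1 t)) (Rabs (rademacher 2 t)) ^ 2).
  { intros t ->; rewrite Rmax_left by apply Rabs_sign_le; ring. }
  (* The value of the integral is written as the sum of the contributions of the two halves. *)
  replace 1 with ((1 / 2 - 0) * 1 + (1 - 1 / 2) * 1) at 2 by field.
  apply (is_RInt_Chasles (V := R_NormedModule) _ 0 (1 / 2) 1).
  - eapply is_RInt_ext; [|apply (is_RInt_const (V := R_NormedModule) 0 (1 / 2) 1)].
    intros t; rewrite Rmin_left, Rmax_right by lra; intros Ht.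
    apply H; rewrite rademacher_1_l by lra; apply Rabs_R1.
  - eapply is_RInt_ext; [|apply (is_RInt_const (V := R_NormedModule) (1 / 2) 1 1)].
    intros t; rewrite Rmin_left, Rmax_right by lra; intros Ht.
    apply H; rewrite rademacher_1_r, Rabs_left; lra.
Qed.

(** * Powers of 1 and 2 *)

Lemma rpow_1 (q : R) : rpow 1 q = 1.
Proof.
  unfold rpow; destruct (Req_EM_T 1 0); [lra|].
  unfold Rpower; rewrite ln_1, Rmult_0_r; apply exp_0.
Qed.

Lemma rpow_2_gt_1 (p : R) : 0 < p -> 1 < rpow 2 p.
Proof.
  intros Hp; unfold rpow; destruct (Req_EM_T 2 0); [lra|].
  (* Here 1 is read as [2^0], so that monotonicity in the exponent applies. *)
  rewrite <- (Rpower_O 2) by lra; apply Rpower_lt; lra.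
Qed.

(** * The norm of the max-norm plane and its cotype constants *)

Section SupPlane.
Context (k : scalar_field).

Definition sup_plane : CompleteNormedModule (scalars k) :=
  sup_prod (scalar_space k) (scalar_space k).

Definition scalar_norm (x : sup_plane) : AbsRing_NormedModule (scalars k) :=
  of_real k (norm x).

(** This is the reverse triangle inequality. *)
Lemma scalar_norm_lipschitz (x y : sup_plane) :
  norm (minus (scalar_norm x) (scalar_norm y)) <= 1 * norm (minus x y).
Proof.
  unfold scalar_norm; rewrite norm_of_real_minus, Rmult_1_l.
  apply (norm_triangle_inv x y).
Qed.

Lemma scalar_norm_zero : scalar_norm zero = zero.
Proof.
  transitivity (of_real k 0); [|apply of_real_0].
  exact (f_equal (of_real k) (norm_zero (V := sup_plane))).
Qed.

Lemma scalar_norm_lip0 : lip0 scalar_norm.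
Proof.
  split; [exact scalar_norm_zero|exists 1; exact scalar_norm_lipschitz].
Qed.

(** Indices start at 1, as in the cotype sums. The default is a unit vector too, so the norm is 1 at
    every index. *)
Definition basis_vector (i : nat) : sup_plane :=
  match i with
  | 1%nat => (unit_vector k, zero)
  | _ => (zero, unit_vector k)
  end.

Lemma norm_basis_vector (i : nat) : norm (basis_vector i) = 1.
Proof.
  assert (H : Rmax 1 0 = 1 /\ Rmax 0 1 = 1)
    by (split; [apply Rmax_left|apply Rmax_right]; lra).
  (* The numbers 1 and 0 become norms of coordinates, so that [H] is the unfolded norm of a basis
     vector. *)
  rewrite <- (norm_unit_vector k), <- (norm_zero (V := scalar_space k)) in H.
  destruct i as [|[|i]]; rewrite <- (norm_unit_vector k); apply H.
Qed.

Lemma norm_basis_combination (a b : R) :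
  norm (plus (scal (of_real k a) (basis_vector 1))
             (scal (of_real k b) (basis_vector 2))) = Rmax (Rabs a) (Rabs b).
Proof.
  pose (z := @zero (CompleteNormedModule.ModuleSpace _ (scalar_space k))).
  transitivity (Rmax
    (norm (plus (scal (of_real k a) (unit_vector k))
                (scal (of_real k b) z)))
    (norm (plus (scal (of_real k a) z)
                (scal (of_real k b) (unit_vector k))))); [reflexivity|].
  unfold z; rewrite !scal_zero_r, plus_zero_r, plus_zero_l.
  now rewrite !norm_scal_unit_vector.
Qed.

Lemma scalar_norm_cotype_bound (q C : R) :
  cotype_bound k q (fun x : sup_plane => scal (scalar_norm x) (unit_vector k)) C ->
  rpow 2 (/ q) <= C.
Proof.
  (* Both weights are 1 and the pairs are [(e1, 0)] and [(e2, 0)]: the left side becomes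
     [(1 + 1)^(1/q)] and the integral becomes 1. *)
  intros H; specialize (H 2%nat (fun _ => 1) basis_vector (fun _ => zero)).
  assert (Hf : forall i, norm (minus
      (scal (scalar_norm (basis_vector i)) (unit_vector k))
      (scal (scalar_norm zero) (unit_vector k))) = 1).
  { intros i; unfold scalar_norm.
    rewrite norm_minus_scal_unit_vector, norm_basis_vector.
    replace (norm (zero : sup_plane)) with 0
      by (symmetry; exact (norm_zero (V := sup_plane))).
    rewrite Rminus_0_r; apply Rabs_R1. }
  rewrite (RInt_ext _
    (fun t => Rmax (Rabs (rademacher 1 t)) (Rabs (rademacher 2 t)) ^ 2)) in H.
  2:{ intros t _; rewrite sum_n_Sm, sum_n_n by auto.
      rewrite !Rmult_1_l, <- (norm_basis_combination _ _); do 2 f_equal.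
      f_equal; f_equal;
        exact (minus_zero_r (G := CompleteNormedModule.ModuleSpace _ sup_plane) _). }
  rewrite (is_RInt_unique _ _ _ _ is_RInt_rademacher_max), sqrt_1 in H.
  rewrite sum_n_Sm, sum_n_n, !Hf, Rabs_R1, !rpow_1 in H by auto.
  change (plus (1 * 1) (1 * 1)) with (1 * 1 + 1 * 1) in H.
  replace (1 * 1 + 1 * 1) with 2 in H by ring; lra.
Qed.

End SupPlane.

Theorem proposition3p8 (k : scalar_field) (q : R) (hq : 2 <= q) :
  ~ is_banach_lipschitz_ideal (scalars k)
      (fun X E => @lip_cotype k q X E)
      (fun X E => @cotype_norm k q X E).
Proof.
  intros H.
  (* With a target vector of norm 1, property (ii) equates the cotype norm of this map with the
     Lipschitz constant of [scalar_norm]. *)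
  destruct (bli_rank_one _ _ _ H (sup_plane k) (scalar_space k) (scalar_norm k)
    (unit_vector k) (scalar_norm_lip0 k)) as [Hcot Hnorm].
  rewrite norm_unit_vector, Rmult_1_r in Hnorm.
  assert (H1 : lip_const (scalar_norm k) <= 1)
    by (apply lip_const_le; [lra|apply scalar_norm_lipschitz]).
  assert (H2 : rpow 2 (/ q) <= 1).
  { eapply Rle_trans; [|exact H1]; rewrite <- Hnorm.
    (* The membership granted by (ii) supplies an admissible constant, so the infimum is a genuine
       one. *)
    apply cotype_norm_ge; [exact Hcot|].
    intros C _; apply scalar_norm_cotype_bound. }
  assert (H3 : 1 < rpow 2 (/ q)) by (apply rpow_2_gt_1, Rinv_0_lt_compat; lra).
  lra.
Qed.
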